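(* For every metric space $X$, the coarse dimension of $X$ equals the large scale dimension of $X$: $\dim^{coa}_{rse}(X)=\dim^{large}_{scale}(X)$.
   Context: Let $(X,d)$ be a metric space. For points, $x_k\to\infty$ means $d(x_k,x_0)\to\infty$ for some (hence every) $x_0\in X$. A function $f:X\to[0,\infty]$ is coarsely proper if $f(x_k)\to\infty$ whenever $x_k\to\infty$. Families of subsets of $X$ need not cover $X$. For a family $\mathcal U$ of subsets of $X$, $L_{\mathcal U}(x)=\sup_{U\in\mathcal U}\mathrm{dist}(x,X\setminus U)\in[0,\infty]$, with $\mathrm{dist}(x,\emptyset)=\infty$ and the supremum over the empty family equal to $0$. The Lebesgue number of $\mathcal U$ is $L(\mathcal U,X)=\inf_{x\in X}L_{\mathcal U}(x)$. The family $\mathcal U$ is coarse if $L_{\mathcal U}$ is coarsely proper. The multiplicity of $\mathcal U$ is the supremum over $x\in X$ of the number of elements of $\mathcal U$ containing $x$. $\mathcal V$ refines $\mathcal U$ if each element of $\mathcal V$ is contained in some element of $\mathcal U$; a coarse refinement is a refinement that is a coarse family. For $A\subset X$ and a family $\mathcal U$ in $X$, $L^n(\mathcal U,A)$ is the supremum of all $t\in[0,\infty]$ such that the family $\mathcal U|_A=\{U\cap A\}_{U\in\mathcal U}$ in the metric space $A$ has a refinement (by subsets of $A$) of multiplicity at most $n+1$ and Lebesgue number (computed in the metric space $A$) at least $t$. Coarse dimension $\dim^{coa}_{rse}(X)$: the smallest integer $n\ge-1$ such that every finite coarse family in $X$ has a coarse refinement of multiplicity at most $n+1$. Large scale dimension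 $\dim^{large}_{scale}(X)$: the smallest integer $n\ge-1$ such that for every finite coarse family $\mathcal U$ in $X$ the function $A\mapsto L^n(\mathcal U,A)$ is coarsely proper on nonempty bounded subsets of $X$, i.e. $L^n(\mathcal U,A_k)\to\infty$ whenever $A_k$ are nonempty bounded subsets with $\mathrm{dist}(x_0,A_k)\to\infty$. In particular it is $-1$ if $X$ is bounded. Each dimension is $\infty$ if no such integer exists. *)

(* Defs.v *)
From HB Require Import structures.
From mathcomp Require Import all_boot all_order all_algebra.
From mathcomp Require Import all_classical all_reals all_analysis.
Set Implicit Arguments.
Unset Strict Implicit.
Unset Printing Implicit Defensive.
Import Order.TTheory GRing.Theory Num.Theory.
Import numFieldNormedType.Exports.
Local Open Scope classical_set_scope.
Local Open Scope ring_scope.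
Local Open Scope ereal_scope.

(* Supremum in [0, +oo]: ereal_sup set0 is -oo, whereas here the supremum of
   the empty set is 0. *)
Definition nneg_sup (R : realType) (S : set (\bar R)) : \bar R := ereal_sup (0 |` S).

(* The distance to a set is the library's edist_inf, which is +oo for the empty
   set; it is built from edist, which on a metric space is mdist. *)
Lemma edist_mdist (R : realType) (X : metricType R) (x y : X) :
  edist (x, y) = (mdist x y)%:E.
Proof.
apply/le_anti/andP; split.
  apply/lee_addgt0Pr => e e0; apply: ereal_inf_lbound.
  exists (mdist x y + e)%R => //; split.
    by rewrite ltr_wpDl ?mdist_ge0.
  by rewrite ballEmdist /= ltrDl.
apply: le_ereal_inf_tmp => _ [r [r0 +] <-].
by rewrite ballEmdist /= lee_fin => /ltW.
Qed.

Section CoarseGeometry.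
Variables (R : realType) (X : metricType R).
Implicit Types (x : X) (A : set X) (U V : set (set X)) (n : int).

Definition goes_to_infty (u : nat -> X) : Prop :=
  exists x0 : X, mdist (u k) x0 @[k --> \oo] --> +oo%R.

Definition coarsely_proper (f : X -> \bar R) : Prop :=
  forall u : nat -> X, goes_to_infty u -> f (u k) @[k --> \oo] --> +oo.

(* The following notions concern a family U of subsets of the metric subspace
   A of X; the metric space X itself is the case A = setT. *)

Definition lebesgue_fun A U x : \bar R :=
  nneg_sup [set edist_inf (A `\` B) x | B in U].

Definition lebesgue_number A U : \bar R :=
  ereal_inf [set lebesgue_fun A U x | x in A].

Definition multiplicity A U : \bar R :=
  nneg_sup [set counting [set B | U B /\ B x] | x in A].

Definition coarse U : Prop := coarsely_proper (lebesgue_fun setT U).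

Definition refines V U : Prop :=
  forall C, V C -> exists2 B, U B & C `<=` B.

Definition family_restr U A : set (set X) := [set B `&` A | B in U].

(* L^n(U, A); a refinement of family_restr U A consists of subsets of A. *)
Definition lebesgue_dim_number n U A : \bar R :=
  nneg_sup [set t : \bar R | 0 <= t /\
    exists V, [/\ refines V (family_restr U A),
                  multiplicity A V <= ((n + 1)%:~R)%:E &
                  t <= lebesgue_number A V]].

Definition metric_bounded A : Prop :=
  exists r : R, forall x y, A x -> A y -> (mdist x y <= r)%R.

Definition sets_go_to_infty (A : nat -> set X) : Prop :=
  exists x0 : X, edist_inf (A k) x0 @[k --> \oo] --> +oo.

Definition coarsely_proper_on_bounded (F : set X -> \bar R) : Prop :=
  forall A : nat -> set X,
    (forall k, A k !=set0 /\ metric_bounded (A k)) ->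
    sets_go_to_infty A ->
    F (A k) @[k --> \oo] --> +oo.

Definition coarse_dim_at_most n : Prop :=
  forall U, finite_set U -> coarse U ->
    exists V, [/\ refines V U, coarse V &
                  multiplicity setT V <= ((n + 1)%:~R)%:E].

Definition large_scale_dim_at_most n : Prop :=
  forall U, finite_set U -> coarse U ->
    coarsely_proper_on_bounded (lebesgue_dim_number n U).

End CoarseGeometry.

(* The smallest integer n >= -1 satisfying P, or +oo if there is none (see
   smallest_dimP). *)
Definition smallest_dim (R : realType) (P : int -> Prop) : \bar R :=
  ereal_inf [set (n%:~R)%:E | n in [set n : int | (-1 <= n)%R /\ P n]].

Lemma smallest_dimP (R : realType) (P : int -> Prop) :
  (exists n : int, [/\ (-1 <= n)%R, P n, smallest_dim R P = (n%:~R)%:E &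
     forall m : int, (-1 <= m)%R -> P m -> (n <= m)%R]) \/
  ((forall n : int, (-1 <= n)%R -> ~ P n) /\ smallest_dim R P = +oo).
Proof.
have [[n0 [n0m Pn0]]|noP] := pselect (exists n : int, (-1 <= n)%R /\ P n).
  left.
  have exQ : exists k : nat, `[< P (k%:Z - 1)%R >].
    exists (absz (n0 + 1)%R); apply/asboolP.
    by rewrite gez0_abs ?addrK// -lerBlDr sub0r.
  case: (ex_minnP exQ) => k /asboolP Pk kmin.
  have kle (m : int) : (-1 <= m)%R -> P m -> (k%:Z - 1 <= m)%R.
    move=> m1 Pm; rewrite lerBlDr.
    have m1' : (0 <= m + 1)%R by rewrite -lerBlDr sub0r.
    rewrite -(gez0_abs m1') lez_nat; apply: kmin; apply/asboolP.
    by rewrite gez0_abs ?addrK.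
  have k1 : (-1 <= k%:Z - 1)%R by rewrite lerBrDr addNr.
  exists (k%:Z - 1)%R; split => //.
  apply/le_anti/andP; split; first by apply: ereal_inf_lbound; exists (k%:Z - 1)%R.
  by apply: le_ereal_inf_tmp => _ [m [m1 Pm] <-]; rewrite lee_fin ler_int kle.
right; have noP' (n : int) : (-1 <= n)%R -> ~ P n by move=> ? ?; apply: noP; exists n.
split=> //; rewrite /smallest_dim (_ : [set n | _] = set0) ?image_set0 ?ereal_inf0//.
by apply/seteqP; split => // n [] /noP'.
Qed.

Definition coarse_dim (R : realType) (X : metricType R) : \bar R :=
  smallest_dim R (@coarse_dim_at_most R X).

Definition large_scale_dim (R : realType) (X : metricType R) : \bar R :=
  smallest_dim R (@large_scale_dim_at_most R X).

(* Main.v *)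
Require Import Defs.
From mathcomp Require Import all_boot all_order all_algebra.
From mathcomp Require Import all_classical all_reals all_analysis.
From mathcomp Require Import finmap zify lra.
Set Implicit Arguments.
Unset Strict Implicit.
Unset Printing Implicit Defensive.
Import Order.TTheory GRing.Theory Num.Theory.
Import numFieldNormedType.Exports.
Local Open Scope classical_set_scope.
Local Open Scope ring_scope.

(** The two dimensions agree because, for each integer n >= -1, the bounds
    coarse dimension <= n and large scale dimension <= n are equivalent.

    A coarse refinement of the whole space, restricted to bounded sets that
    move off to infinity, has Lebesgue numbers tending to infinity; this gives
    the large scale bound (coarse_large_scale).

    For the converse, fix a base point x0 and cut X into the shells
    k^2 <= d(x, x0) < (k+1)^2. The shells of even index are far apart from each
    other, at mutual distances growing with k, and so are those of odd index.
    The large scale bound provides on the shell A_k a refinement of multiplicity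
    at most n+1 whose Lebesgue number tends to infinity with k, and since shells
    of one parity are far apart these refinements do not interfere: with E the
    union of the shells of that parity, they assemble into one refinement over E
    (dim_at_most_on_pieces). The two parities are then combined as in the sum
    theorem for the covering dimension of normal spaces: shrink the family so as
    to reduce the multiplicity on the first piece, then shrink the result so as
    to reduce it on the second (dim_at_most_on_setU). The first bound survives
    the second step because a shrinking replaces each member by one subset of
    it, whereas a mere refinement could split members.

    To extend a shrinking from E to X one takes (B \ E) together with the part
    of B chosen in E. This is coarse only if the chosen part lies deep inside B
    in the sense of X and not of E. Hence the large scale bound is applied not
    to the given family U but to the family of the cores of its members, the
    core of B being the set of points at which B is, up to a factor 2, as deep
    as any member of U; this family is again coarse (core_far_balls).

    Throughout, coarseness is used in the form far_balls: at points far away,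
    large balls fit inside members of the family (coarseP). *)

(** * Counting, diagonal choice, finite maxima *)

Lemma counting_le_image (R : realType) (S T : choiceType) (f : S -> T)
    (A : set S) (B : set T) :
  B `<=` f @` A -> (counting B <= counting A :> \bar R)%E.
Proof.
move=> BfA; rewrite /counting.
case: (asboolP (finite_set A)) => [finA|_]; last exact: leey.
have finfA : finite_set (f @` A) by exact: finite_image.
have finB : finite_set B by exact: sub_finite_set finfA.
rewrite asboolT// lee_fin ler_nat.
apply: (@leq_trans #|` fset_set (f @` A)|).
  by apply: fsubset_leq_card; rewrite -fset_set_sub.
by rewrite fset_set_image// leq_imfset_card.
Qed.

Lemma le_counting (R : realType) (T : choiceType) (A B : set T) :
  B `<=` A -> (counting B <= counting A :> \bar R)%E.
Proof.
move=> BA; apply: (@counting_le_image _ _ _ id) => x Bx.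
by exists x => //; exact: BA.
Qed.

(** Turns a property that for each level c holds eventually in k into one level
    c k tending to infinity: take the largest level at most k that works for k.
    The hypothesis on level 0 makes this set of levels nonempty. *)
Lemma diagonal_unbounded (P : nat -> nat -> Prop) :
  (forall k, P k 0%N) ->
  (forall c, exists N, forall k, (N <= k)%N -> P k c) ->
  exists2 c : nat -> nat, forall k, P k (c k) &
    forall m, exists N, forall k, (N <= k)%N -> (m <= c k)%N.
Proof.
move=> P0 Pc.
have maxP k : exists c : nat, P k c /\
    forall m, (m <= k)%N -> P k m -> (m <= c)%N.
  have exP : exists c, `[< (c <= k)%N /\ P k c >].
    by exists 0%N; apply/asboolP.
  have bdP c : `[< (c <= k)%N /\ P k c >] -> (c <= k)%N by move=> /asboolP[].
  case: (ex_maxnP exP bdP) => c /asboolP[_ Pkc] cmax.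
  by exists c; split=> // m mk Pkm; apply: cmax; apply/asboolP.
exists (fun k => projT1 (cid (maxP k))) => [k|m]; first by case: cid => c [].
have [N NP] := Pc m; exists (maxn N m) => k; rewrite geq_max => /andP[Nk mk].
by case: cid => c [_ cmax] /=; apply: cmax => //; exact: NP.
Qed.

Lemma finite_total_preorder_max (T : choiceType) (A : set T)
    (le : T -> T -> Prop) :
  finite_set A -> A !=set0 ->
  (forall a b, le a b \/ le b a) ->
  (forall a b c, le a b -> le b c -> le a c) ->
  exists2 m, A m & forall a, A a -> le a m.
Proof.
move=> /finite_seqP[s ->{A}] [a0 sa0] letot letrans.
have lexx a : le a a by case: (letot a a).
elim: s a0 sa0 => [//|b s IH] a0 _.
have [[c sc]|nos] := pselect (exists c, c \in s); last first.
  exists b; first by rewrite /= mem_head.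
  move=> a /=; rewrite inE => /orP[/eqP->//|sa].
  by exfalso; apply: nos; exists a.
have [m /= sm mmax] := IH c sc.
have [bm|mb] := letot b m.
  exists m => [|a /=]; first by rewrite /= inE sm orbT.
  by rewrite inE => /orP[/eqP->//|]; exact: mmax.
exists b => [|a /=]; first by rewrite /= mem_head.
rewrite inE => /orP[/eqP->//|sa].
exact: letrans (mmax _ sa) mb.
Qed.

(** * Lebesgue functions in terms of balls *)

Section Balls.
Variables (R : realType) (X : metricType R).
Implicit Types (x y : X) (A B E : set X) (U V : set (set X)).

Lemma ballP x y (r : R) : ball x r y <-> mdist x y < r.
Proof. by rewrite ballEmdist. Qed.

Lemma ball_subset x y (r s : R) : mdist x y + r <= s -> ball y r `<=` ball x s.
Proof.
move=> xyrs z /ballP yzr; apply/ballP.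
have := metric_triangle x y z; lra.
Qed.

Lemma le_ball_subset x (r s : R) : r <= s -> ball x r `<=` ball x s.
Proof. by move=> rs; apply: ball_subset; rewrite mdistxx add0r. Qed.

Lemma lebesgue_fun_ge A U B x (C : R) :
  U B -> A `&` ball x C `<=` B -> (C%:E <= lebesgue_fun A U x)%E.
Proof.
move=> UB AB; apply: (@le_trans _ _ (edist_inf (A `\` B) x)); last first.
  by apply: ereal_sup_ubound; right; exists B.
apply: le_ereal_inf_tmp => _ [y [Ay nBy] <-].
rewrite edist_mdist lee_fin leNgt; apply/negP => xyC.
by apply: nBy; apply: AB; split=> //; apply/ballP.
Qed.

Lemma lebesgue_fun_gt A U x (C : R) :
  0 <= C -> (C%:E < lebesgue_fun A U x)%E ->
  exists2 B, U B & A `&` ball x C `<=` B.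
Proof.
move=> C0 /ereal_sup_gt[_ [->|[B UB <-]]].
  by rewrite lte_fin ltNge C0.
move=> CB; exists B => // y [Ay /ballP xyC]; apply: contrapT => nBy.
move: CB; apply/negP; rewrite -leNgt.
apply: (@le_trans _ _ (edist (x, y))).
  by apply: ereal_inf_lbound; exists y.
by rewrite edist_mdist lee_fin ltW.
Qed.

(** The elementary form of coarseness, with all suprema, infima and sequences
    removed. *)
Definition far_balls x0 U : Prop := forall C : R, 0 < C ->
  exists r : R, forall x, r <= mdist x x0 -> exists2 B, U B & ball x C `<=` B.

Lemma mdist_ge_id_cvgy (u : nat -> X) x0 :
  (forall k, k%:R <= mdist (u k) x0) ->
  mdist (u k) x0 @[k --> \oo] --> +oo.
Proof.
move=> uk; apply/cvgryPge => C; near=> k.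
by apply: (le_trans _ (uk k)); near: k; exact: nbhs_infty_ger.
Unshelve. all: by end_near. Qed.

(** If balls of radius C fail to fit at points arbitrarily far away, then these
    points form a sequence going to infinity along which the Lebesgue function
    is at most C. The choice of x0 is immaterial: replacing x1 by x0 in the
    definition of going to infinity costs the constant d(x1, x0). *)
Lemma coarseP x0 U : coarse U <-> far_balls x0 U.
Proof.
split=> [cU C C0|fU u [x1 ux1]].
  apply: contrapT => nr.
  have exu k : exists x, k%:R <= mdist x x0 /\
      ~ exists2 B, U B & ball x C `<=` B.
    apply: contrapT => nx; apply: nr; exists k%:R => x kx.
    by apply: contrapT => nB; apply: nx; exists x.
  have /choice[u uP] := exu.
  have /cvgeyPgt/(_ C)[N _ /(_ _ (leqnn N))] := cU u
    (ex_intro _ x0 (mdist_ge_id_cvgy (fun k => proj1 (uP k)))).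
  move=> /(lebesgue_fun_gt (ltW C0))[B UB]; rewrite setTI => BC.
  by case: (proj2 (uP N)); exists B.
apply/cvgeyPge => C.
have C1 : 0 < Num.max C 1 by rewrite lt_max ltr01 orbT.
have [r rP] := fU _ C1.
move/cvgryPge/(_ (r + mdist x1 x0)) : ux1; apply: filterS => k uk.
have [|B UB BC] := rP (u k).
  have := metric_triangle (u k) x0 x1; rewrite (metric_sym x0 x1); lra.
apply: (@le_trans _ _ (Num.max C 1)%:E); first by rewrite lee_fin le_max lexx.
by apply: (lebesgue_fun_ge UB); rewrite setTI.
Qed.

Lemma multiplicity_le A U x (m : \bar R) :
  (multiplicity A U <= m)%E -> A x ->
  (counting [set B | U B /\ B x] <= m)%E.
Proof.
move=> Um Ax; apply: le_trans Um; apply: ereal_sup_ubound.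
by right; exists x.
Qed.

Lemma multiplicity_leP A U (m : \bar R) : (0 <= m)%E ->
  (forall x, A x -> (counting [set B | U B /\ B x] <= m)%E) ->
  (multiplicity A U <= m)%E.
Proof.
by move=> m0 Um; apply: ge_ereal_sup => _ [->//|[x Ax <-]]; exact: Um.
Qed.

End Balls.

(** * From coarse dimension to large scale dimension *)

Section CoarseToLargeScale.
Variables (R : realType) (X : metricType R) (n : int).
Hypothesis n_ge : -1 <= n.

Lemma mult_bound_ge0 : (0 <= ((n + 1)%:~R)%:E :> \bar R)%E.
Proof. by rewrite lee_fin ler0z; lia. Qed.

Lemma coarse_large_scale :
  coarse_dim_at_most X n -> large_scale_dim_at_most X n.
Proof.
move=> cn U finU cU A Abd [x0 Ax0]; apply/cvgeyPge => C.
have [V [VU cV Vn]] := cn U finU cU.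
have C1 : 0 < Num.max C 1 by rewrite lt_max ltr01 orbT.
have /(coarseP x0) fV := cV; have [r rP] := fV _ C1.
move/cvgeyPge/(_ r) : Ax0; apply: filterS => k rA.
apply: (@le_trans _ _ (Num.max C 1)%:E); first by rewrite lee_fin le_max lexx.
apply: ereal_sup_ubound; right; split; first by rewrite lee_fin ltW.
exists (family_restr V (A k)); split.
- move=> _ [B VB <-]; have [D UD BD] := VU _ VB.
  by exists (D `&` A k); [exists D | exact: setSI].
- apply: multiplicity_leP mult_bound_ge0 _ => x _.
  apply: (le_trans _ (multiplicity_le Vn (I : setT x))).
  apply: (@counting_le_image _ _ _ (fun B => B `&` A k)).
  by move=> _ [[B VB <-] [Bx _]]; exists B.
- apply: le_ereal_inf_tmp => _ [x Akx <-].
  have [|B VB BC] := rP x.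
    rewrite -lee_fin; apply: (le_trans rA); rewrite metric_sym -edist_mdist.
    by apply: ereal_inf_lbound; exists x.
  apply: (@lebesgue_fun_ge _ _ _ _ (B `&` A k)); first by exists B.
  by move=> y [Aky xy]; split=> //; exact: BC.
Qed.

End CoarseToLargeScale.

(** * Cores of a coarse family *)

Section LargeScaleToCoarse.
Variables (R : realType) (X : metricType R) (n : int).
Hypothesis n_ge : -1 <= n.
Implicit Types (x y : X) (A B E : set X) (U V : set (set X)).

(** In terms of distances, core U B consists of the points x of B such that
    dist (x, X \ B) is at least half of the Lebesgue function of U at x. It is
    phrased with balls so that infinite distances need no separate treatment. *)
Definition core U B : set X :=
  [set x | B x /\ forall r : R, (exists2 D, U D & ball x (2 * r) `<=` D) ->
     ball x r `<=` B].

(** A deepest member B of U at x exists as U is finite. Since depths are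
    1-Lipschitz in the point, B is still at least half as deep as any other
    member at every point whose distance to x is at most a third of the depth
    of B at x. *)
Lemma core_far_balls x0 U :
  finite_set U -> far_balls x0 U -> far_balls x0 (core U @` U).
Proof.
move=> finU fU C C0.
have [|r rP] := fU (3 * C); first lra.
exists r => x /rP[B0 UB0 B0x].
have [|||B UB Bmax] := @finite_total_preorder_max _ U
  (fun B D => forall r, ball x r `<=` B -> ball x r `<=` D) finU.
- by exists B0.
- move=> B D; apply: contrapT => /not_orP[/existsNP[s] + /existsNP[t]].
  move=> /not_implyP[sB nsD] /not_implyP[tD ntB].
  have [st|/ltW ts] := leP s t.
    by apply: nsD; apply: subset_trans (le_ball_subset st) tD.
  by apply: ntB; apply: subset_trans (le_ball_subset ts) sB.
- by move=> B D F BD DF s sB; apply: DF; exact: BD.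
exists (core U B); first by exists B.
have xB : ball x (3 * C) `<=` B by apply: Bmax UB0 _ B0x.
move=> y /ballP xy; split; first by apply: xB; apply/ballP; lra.
move=> s [D UD yD].
(* Moving from y to x and back costs 2 * C, and 2 * s - 2 * C is still at least
   s once 2 * C <= s; smaller balls around y lie in the ball xB. *)
have [s2C|s2C] := leP s (2 * C).
  by apply: subset_trans xB; apply: ball_subset; lra.
have xD : ball x (2 * s - C) `<=` B.
  apply: Bmax UD _ _; apply: subset_trans yD.
  by apply: ball_subset; rewrite metric_sym; lra.
by apply: subset_trans xD; apply: ball_subset; lra.
Qed.

(** * Shrinkings on pieces and their union *)

(** The large scale bound uniformly over all bounded sets far from x0: sets
    violating it ever farther away would form a sequence contradicting the
    definition. *)
Lemma large_scale_uniform U x0 (C : R) : large_scale_dim_at_most X n ->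
  finite_set U -> coarse U -> 0 <= C ->
  exists r : R, forall A, A !=set0 -> metric_bounded A ->
    (forall x, A x -> r <= mdist x x0) ->
    exists V, [/\ refines V (family_restr U A),
      (multiplicity A V <= ((n + 1)%:~R)%:E)%E &
      (C%:E < lebesgue_number A V)%E].
Proof.
move=> ln finU cU C0; apply: contrapT => nr.
have exA k : exists A, [/\ A !=set0, metric_bounded A,
    forall x, A x -> k%:R <= mdist x x0 &
    ~ exists V, [/\ refines V (family_restr U A),
      (multiplicity A V <= ((n + 1)%:~R)%:E)%E &
      (C%:E < lebesgue_number A V)%E]].
  apply: contrapT => nA; apply: nr; exists k%:R => A A0 Abd Afar.
  by apply: contrapT => nV; apply: nA; exists A.
have /choice[A AP] := exA.
have Aoo : sets_go_to_infty A.
  exists x0; apply/cvgeyPge => D; near=> k.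
  apply: le_ereal_inf_tmp => _ [y Aky <-].
  rewrite edist_mdist lee_fin metric_sym.
  have [_ _ /(_ _ Aky) ky _] := AP k; apply: le_trans ky.
  by near: k; exact: nbhs_infty_ger.
have Abd k : A k !=set0 /\ metric_bounded (A k) by have [] := AP k.
have /cvgeyPgt/(_ C)[N _ /(_ _ (leqnn N))] := ln U finU cU A Abd Aoo.
move=> /ereal_sup_gt[t [->|[_ [V [VU Vn tV]]]]].
  by rewrite lte_fin ltNge C0.
move=> Ct; have [_ _ _ []] := AP N.
by exists V; split=> //; exact: lt_le_trans tV.
Unshelve. all: by end_near. Qed.

(** A refinement over A of the family s B, B in U, regrouped as one set v B for
    each index B in U; C is a lower bound of its Lebesgue number. The
    multiplicity counts indices, so that it stays meaningful when the sets v B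
    are enlarged outside A. For C = 0 balls are empty and no member of U need
    exist, hence the guard 0 < C. *)
Definition shrinking_on A U (s v : set X -> set X) (C : R) :=
  [/\ forall B, U B -> v B `<=` s B,
      forall x, A x ->
        (counting [set B | U B /\ v B x] <= ((n + 1)%:~R)%:E :> \bar R)%E &
      0 < C -> forall x, A x -> exists2 B, U B & A `&` ball x C `<=` v B].

(** Let v B be the union of the members assigned to B by a choice of a
    containing s B for each. Merging members does not raise the multiplicity, nor
    does it lower the Lebesgue number. *)
Lemma shrinking_on_of_refinement A U (s : set X -> set X) V (C : R) :
  refines V (family_restr (s @` U) A) ->
  (multiplicity A V <= ((n + 1)%:~R)%:E)%E ->
  (C%:E < lebesgue_number A V)%E ->
  exists v, shrinking_on A U s v C.
Proof.
move=> VU Vn CV.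
have exc D : exists B, V D -> U B /\ D `<=` s B.
  have [VD|nVD] := pselect (V D); last by exists set0.
  have [_ [_ [B UB <-] <-] DB] := VU _ VD.
  by exists B => _; split=> // x /DB[].
have /choice[c cP] := exc.
exists (fun B => \bigcup_(D in [set D | V D /\ c D = B]) D); split.
- by move=> B UB x [D [VD <-] Dx]; apply: (proj2 (cP _ VD)).
- move=> x Ax; apply: (le_trans _ (multiplicity_le Vn Ax)).
  apply: (@counting_le_image _ _ _ c) => B [UB [D [VD cD] Dx]].
  by exists D.
- move=> C0 x Ax.
  have [|D VD DC] := @lebesgue_fun_gt _ _ A V x C (ltW C0).
    by apply: (lt_le_trans CV); apply: ereal_inf_lbound; exists x.
  exists (c D); first exact: (proj1 (cP _ VD)).
  by move=> y /DC Dy; exists D.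
Qed.

(** The relative version over a subset E: the family f B is coarse in all of X,
    and only its multiplicity is restricted to E. Asking for one subset f B of
    each B, and not for an arbitrary refinement, is what makes the property
    stable under iteration. *)
Definition dim_at_most_on E : Prop := forall U, finite_set U -> coarse U ->
  exists f : set X -> set X,
    [/\ forall B, U B -> f B `<=` B, coarse (f @` U) &
        (multiplicity E (f @` U) <= ((n + 1)%:~R)%:E)%E].

(** Shrink U by f for E, then the resulting family by g for F. At a point of E,
    each set g (f B) containing it comes from a set f B containing it, so the
    second step preserves the bound gained in the first. *)
Lemma dim_at_most_on_setU E F :
  dim_at_most_on E -> dim_at_most_on F -> dim_at_most_on (E `|` F).
Proof.
move=> dE dF U finU cU.
have [f [fB cf fn]] := dE U finU cU.
have [g [gB cg gn]] := dF _ (finite_image f finU) cf.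
have gfB B : U B -> g (f B) `<=` f B by move=> UB; apply: gB; exists B.
exists (g \o f); rewrite -image_comp; split=> //.
  by move=> B UB; apply: subset_trans (gfB _ UB) (fB _ UB).
apply: multiplicity_leP (mult_bound_ge0 _ n_ge) _ => x [Ex|Fx].
  apply: (le_trans _ (multiplicity_le fn Ex)).
  apply: (@counting_le_image _ _ _ g) => _ [[D fUD <-] gDx].
  by exists D => //; split=> //; exact: gB gDx.
exact: multiplicity_le gn Fx.
Qed.

(** If E is cut by kappa into bounded pieces that run off to infinity and whose
    mutual distances are at least their index, then shrinkings v_k of the cores
    on the pieces A_k, of Lebesgue number c_k tending to infinity, glue to
    f B = (B \ E) together with the sets v_k B. At a far point x of A_k, large
    balls around x meet E only within A_k, hence only within v_k B for some B;
    as x is in the core of this B, they lie in B and thus in f B. A point near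
    E inherits a ball from a point of E, and a point far from E has its balls
    inside some B \ E. *)
Lemma dim_at_most_on_pieces x0 E (kappa : X -> nat) :
  large_scale_dim_at_most X n ->
  (forall k, metric_bounded (E `&` kappa @^-1` [set k])) ->
  (forall k x, kappa x = k -> k%:R <= mdist x x0) ->
  (forall m : nat, exists r : R,
    forall x, r <= mdist x x0 -> (m <= kappa x)%N) ->
  (forall x y, E x -> E y -> mdist x y < (kappa x)%:R -> kappa y = kappa x) ->
  dim_at_most_on E.
Proof.
move=> ln bdA farA kappa_oo sepA U finU cU.
have /(coarseP x0) fU := cU.
have fsU := core_far_balls finU fU.
have csU : coarse (core U @` U) by apply/(coarseP x0).
set s := core U in fsU csU.
have finsU : finite_set (s @` U) by exact: finite_image.
pose A k := E `&` kappa @^-1` [set k].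
(* Level 0 is vacuous: the empty shrinking has multiplicity 0 <= n + 1. *)
have [|c|c cP c_oo] := @diagonal_unbounded
  (fun k c => exists v, shrinking_on (A k) U s v c%:R).
- move=> k; exists (fun=> set0); split=> [|x _|]; last by rewrite ltxx.
    by move=> B _ x.
  apply: (@le_trans _ _ (counting (@set0 (set X)))).
    by apply: le_counting => B [].
  by rewrite /counting asboolT// fset_set0 cardfs0 (mult_bound_ge0 _ n_ge).
- have [r rP] := large_scale_uniform x0 ln finsU csU (ler0n R c).
  exists (Num.bound r) => k rk.
  have [A0|nA0] := pselect (A k !=set0).
    have [|V [VU Vn CV]] := rP _ A0 (bdA k).
      move=> x [_ xk]; apply: le_trans (farA k x xk).
      have := unstable.ltr_bound r; move: rk; rewrite -(ler_nat R); lra.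
    exact: shrinking_on_of_refinement VU Vn CV.
  by exists (fun=> set0); split=> [B _ x//|x Ax|_ x Ax]; case: nA0; exists x.
have /choice[v vP] := cP.
pose f B := (B `\` E) `|` [set x | E x /\ v (kappa x) B x].
have fB B : U B -> f B `<=` B.
  move=> UB x [[]//|[Ex vx]].
  by have [/(_ _ UB _ vx)[]] := vP (kappa x).
(* The case of centres in E; the passage to X doubles the radius. *)
have on_E (C : R) : 0 < C -> exists r : R, forall x, E x -> r <= mdist x x0 ->
    exists2 B, U B & ball x C `<=` f B.
  move=> C0.
  have [|r rP] := fU (2 * C); first lra.
  have [N NP] := c_oo (Num.bound C).
  have [r' r'P] := kappa_oo (maxn N (Num.bound C)).
  exists (Num.max r r') => x Ex; rewrite ge_max => /andP[/rP xr /r'P].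
  rewrite geq_max => /andP[/NP Nx Cx].
  have ltb (m : nat) : (Num.bound C <= m)%N -> C < m%:R.
    move=> Cm; apply: (lt_le_trans (archi_boundP (ltW C0))).
    by rewrite ler_nat.
  have [vs _] := vP (kappa x).
  have Ax : A (kappa x) x by split.
  move=> /(_ (lt_trans C0 (ltb _ Nx)) _ Ax)[B UB vB].
  have inv y : A (kappa x) y -> mdist x y < C -> v (kappa x) B y.
    move=> Ay xy; apply: vB; split=> //; apply/ballP.
    exact: lt_trans xy (ltb _ Nx).
  have /vs : v (kappa x) B x by apply: inv => //; rewrite mdistxx.
  move=> /(_ UB)[Bx corex]; exists B => // y /ballP xy.
  have [Ey|nEy] := pselect (E y); last first.
    by left; split=> //; apply: corex xr _ _; exact/ballP.
  have kyx : kappa y = kappa x.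
    by apply: sepA => //; exact: lt_trans xy (ltb _ Cx).
  by right; split=> //; rewrite kyx; apply: inv.
exists f; split=> //; last first.
  apply: multiplicity_leP (mult_bound_ge0 _ n_ge) _ => x Ex.
  have [_ /(_ x (conj Ex erefl)) vn _] := vP (kappa x).
  apply: le_trans vn; apply: (@counting_le_image _ _ _ f).
  by move=> _ [[B UB <-] [[_ //]|[_ vx]]]; exists B.
apply/(coarseP x0) => C C0.
have [|r rP] := on_E (2 * C); first lra.
have [r' r'P] := fU C C0.
exists (Num.max (r + C) r') => x; rewrite ge_max => /andP[xr /r'P[B UB xB]].
have [[e [Ee /ballP xe]]|nE] := pselect (exists e, E e /\ ball x C e).
  have [|D UD eD] := rP e Ee; first by have := metric_triangle x e x0; lra.
  exists (f D); first by exists D.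
  by apply: subset_trans eD; apply: ball_subset; rewrite metric_sym; lra.
exists (f B); first by exists B.
move=> y xy; left; split; first exact: xB.
by move=> Ey; apply: nE; exists y.
Qed.

(** * Shells *)

(** Bounded pieces need gaps that grow, so the radii k^2 are used: two
    consecutive shells of equal parity are separated by a shell of some index k,
    which has thickness 2k+1. *)
Definition shell x0 x : nat := Num.truncn (Num.sqrt (mdist x x0)).

Lemma shell_itv x0 x :
  (shell x0 x)%:R ^+ 2 <= mdist x x0 < (shell x0 x).+1%:R ^+ 2.
Proof.
have /andP[lo hi] := truncn_itv (sqrtr_ge0 (mdist x x0)).
rewrite -[mdist x x0]sqr_sqrtr ?mdist_ge0//.
by rewrite ler_sqr ?ltr_sqr ?nnegrE ?ler0n ?sqrtr_ge0// lo hi.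
Qed.

Lemma shell_sep x0 x y : odd (shell x0 x) = odd (shell x0 y) ->
  mdist x y < (shell x0 x)%:R -> shell x0 y = shell x0 x.
Proof.
have /andP[xlo xhi] := shell_itv x0 x; have /andP[ylo yhi] := shell_itv x0 y.
move: (shell x0 x) (shell x0 y) xlo xhi ylo yhi => k l xlo xhi ylo yhi kl xyk.
have := metric_triangle x y x0; have := metric_triangle y x x0.
rewrite (metric_sym y x) => yx0 xy0.
rewrite -natr1 in xhi; rewrite -natr1 in yhi.
(* The smaller index is a and the larger b; p < (a+1)^2 <= (b-1)^2 and b^2 <= q
   leave a gap of at least 2b-1 >= b. *)
have gap (a b p q : R) : 0 <= a -> a + 2 <= b -> p < (a + 1) ^+ 2 ->
    b ^+ 2 <= q -> q <= mdist x y + p -> mdist x y < b -> False.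
  move: (mdist x y) => m a0 ab pa bq qm mb.
  have : 0 <= (b - a - 2) * (b + a) by apply: mulr_ge0; lra.
  nra.
have [kl2|lk2|//] := ltngtP k l; exfalso.
- have kl2R : k%:R + 2 <= l%:R :> R by rewrite -natrD ler_nat; lia.
  by apply: (gap _ _ _ _ (ler0n R k) kl2R xhi ylo yx0); lra.
- have lk2R : l%:R + 2 <= k%:R :> R by rewrite -natrD ler_nat; lia.
  exact: (gap _ _ _ _ (ler0n R l) lk2R yhi xlo xy0 xyk).
Qed.

(** * From large scale dimension to coarse dimension *)

Lemma large_scale_coarse :
  large_scale_dim_at_most X n -> coarse_dim_at_most X n.
Proof.
move=> ln U finU cU.
have [[x0 _]|noX] := pselect (exists x : X, True); last first.
  exists set0; split=> [B []|u|].
    by exfalso; apply: noX; exists (u 0%N).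
  apply: multiplicity_leP (mult_bound_ge0 _ n_ge) _ => x _.
  by exfalso; apply: noX; exists x.
have dim_parity b : dim_at_most_on [set x | odd (shell x0 x) = b].
  apply: (dim_at_most_on_pieces (x0 := x0) (kappa := shell x0)) => //.
  - move=> k; exists (2 * k.+1%:R ^+ 2) => x y [_ /= xk] [_ /= yk].
    have /andP[_ xhi] := shell_itv x0 x; have /andP[_ yhi] := shell_itv x0 y.
    have := metric_triangle x x0 y; rewrite (metric_sym x0 y).
    by rewrite xk yk in xhi yhi; lra.
  - move=> k x xk; have /andP[xlo _] := shell_itv x0 x.
    apply: le_trans xlo; rewrite xk -natrX ler_nat; nia.
  - move=> m; exists (m%:R ^+ 2) => x xm; have /andP[_ xhi] := shell_itv x0 x.
    have := le_lt_trans xm xhi; rewrite ltr_sqr ?nnegrE ?ler0n// ltr_nat; lia.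
  - by move=> x y /= xb yb; apply: shell_sep; rewrite xb yb.
have [f [fB cf fn]] :=
  dim_at_most_on_setU (dim_parity true) (dim_parity false) finU cU.
exists (f @` U); split=> //.
  by move=> _ [B UB <-]; exists B => //; exact: fB.
apply: multiplicity_leP (mult_bound_ge0 _ n_ge) _ => x _.
apply: (multiplicity_le fn) => /=.
by case: (odd _); [left|right].
Qed.

End LargeScaleToCoarse.

Theorem corollary6p7 (R : realType) (X : metricType R) :
  coarse_dim X = large_scale_dim X.
Proof.
rewrite /coarse_dim /large_scale_dim /smallest_dim.
congr (ereal_inf (_ @` _)); apply/seteqP; split=> n [n1 dn]; split=> //=.
- exact: coarse_large_scale.
- exact: large_scale_coarse.
Qed.
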